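(* Let $r>0$ be a positive integer and let $c>0$ be a real constant. For every integer $k\ge 1$ there exists a constant $C_k>0$, depending only on $k$, such that for every real $\epsilon>0$ there exists $N_0$, depending only on $\epsilon$ and $k$ (and on the fixed $r$ and $c$), with the following property. For every polynomial $P_k$ of degree $k$ with integer coefficients and all integers $a,q,N$ with $N>0$, $N>N_0$ and $|q|\le c\,N^{r}$, we have $$\bigl|\{t\in\mathbb{Z}:\ P_k(t)\in\{a+q,a+2q,\ldots,a+Nq\}\}\bigr|\le C_k\,N^{\frac1k+\epsilon}.$$
   Context: $|S|$ denotes the cardinality of a set $S$, and $|q|$ the absolute value of the integer $q$. *)

(* Defs.v *)
From mathcomp Require Import all_boot all_order all_algebra.
From mathcomp Require Import finmap.
From mathcomp Require Import all_classical all_reals all_analysis.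

Set Implicit Arguments.
Unset Strict Implicit.
Unset Printing Implicit Defensive.

Import Order.TTheory GRing.Theory Num.Theory.

Local Open Scope classical_set_scope.
Local Open Scope ring_scope.

(* {a + q, a + 2q, ..., a + Nq}; the step q may be zero or negative. *)
Definition arith_prog (a q N : int) : set int :=
  [set a + j * q | j in [set j : int | 1 <= j <= N]].

Definition hits (P : {poly int}) (a q N : int) : set int :=
  [set t : int | arith_prog a q N P.[t]].

(* |S| <= B for a real bound B: finiteness is required explicitly because
   [fset_set] sends every infinite set to the empty one. *)
Definition card_le_real (R : realType) (T : choiceType) (S : set T) (B : R) :
    Prop :=
  finite_set S /\ (#|` fset_set S|%fset)%:R <= B.

(* Main.v *)
Require Import Defs.
From mathcomp Require Import all_boot all_order all_algebra.
From mathcomp Require Import finmap.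
From mathcomp Require Import all_classical all_reals all_analysis.
From mathcomp Require Import zify ring lra.
Import Order.TTheory GRing.Theory Num.Theory.
Local Open Scope classical_set_scope.
Local Open Scope ring_scope.

(** Put f = P - a, let b be its leading coefficient, and let S be a finite set
    of hits, so that every t in S satisfies f(t) = j q with 0 < j <= N. The
    bound comes from one principle, applied once for each prime factor of q
    and once for the usual absolute value: a polynomial of degree k with
    leading coefficient b can be small only near at most k points. Indeed, at
    k + 1 points that are mutually far apart, b is the k-th divided difference
    of the values of f, so if these values are small, b would be smaller than
    it is ([lead_coef_ind]). If on the other hand S has no k + 1 mutually far
    points, then a single neighbourhood contains at least #|S| / k of its
    points ([pairwise_far_or_crowded]).

    At a prime p with p^e exactly dividing q, small means divisible by p^e.
    With s minimal such that p^e divides b p^(s k), some class modulo p^s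
    contains a k-th of the points ([class_mod_prime_power]). Doing this for
    every prime factor of q costs a factor k^omega(q), and leaves a set S'
    inside one class modulo some m with |q| <= |b| m^k
    ([class_mod_large_modulus]).

    At the real place, small means |f(t)| <= N |q|. If L^k > 2^k N, then k + 1
    points of S' cannot be mutually at distance at least L m: this would give
    |b| (L m)^k <= 2^k N |q|, whereas |b| m^k >= |q|. So a k-th of S' lies in
    an interval of radius L m, and there one class modulo m has at most 2 L
    elements. Hence #|S| <= k^omega(q) * 2 k L ([size_hits]), with L of size
    about 2 N^(1/k).

    Finally k^omega(q) is at most |q|^delta times a constant for every
    delta > 0 ([expn_size_primes]), hence at most N^eps as soon as N is large,
    because |q| <= c N^r. *)

(** * Descent to the leading coefficient *)

Lemma difference_quotient (R : comNzRingType) (f : {poly R}) (k : nat) (u : R) :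
  size f = k.+2 ->
  exists2 g : {poly R}, size g = k.+1 /\ lead_coef g = lead_coef f
    & forall x, (x - u) * g.[x] = f.[x] - f.[u].
Proof.
move=> szf.
have /factor_theorem[g fE] : root (f - f.[u]%:P) u.
  by rewrite rootE !hornerE subrr.
have lt_c : (size (- f.[u]%:P)%R < size f)%N.
  by rewrite szf size_polyN ltnS (leq_trans (size_polyC_leq1 _)).
have lead_g : lead_coef g = lead_coef f.
  by rewrite -(lead_coefDl lt_c) fE lead_coef_Mmonic // monicXsubC.
have g0 : g != 0 by rewrite -lead_coef_eq0 lead_g lead_coef_eq0 -size_poly_eq0 szf.
exists g.
  split=> //; apply/eqP.
  by rewrite -eqSS -szf -(size_polyDl lt_c) fE size_Mmonic ?monicXsubC //
    size_XsubC addnS addn1.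
move=> x; have := congr1 (horner^~ x) fE.
by rewrite hornerM !hornerE => ->; rewrite mulrC.
Qed.

(** Divided differences without denominators. Replacing f by the difference
    quotient (f(x) - f(u)) / (x - u) lowers the degree by one and keeps the
    leading coefficient; the price is the point u and a division by differences
    of far points. So if [Phi n] bounds the divided differences of order n and
    survives such a division, it reaches the leading coefficient after k
    steps. *)
Lemma lead_coef_ind (R : comNzRingType) (far : rel R) (Phi : nat -> R -> Prop) :
    (forall n x u y v z, far u x -> Phi n y -> Phi n v ->
       (x - u) * z = y - v -> Phi n.+1 z) ->
  forall (f : {poly R}) k s, size f = k.+1 -> size s = k.+1 -> pairwise far s ->
    (forall x, x \in s -> Phi 0%N f.[x]) -> Phi k (lead_coef f).
Proof.
(* The starting order 0 is generalized: after one step, the values of the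
   difference quotient satisfy [Phi 1]. *)
move=> PhiS f k s szf szs far_s Phi_f; rewrite -[k]add0n.
elim: k f s (0%N) szf szs far_s Phi_f => [|k IHk] f [//|u s] n szf /=.
  case: s => // _ _ /(_ u (mem_head _ _)).
  rewrite [f]size1_polyC ?szf // hornerC lead_coefC. by rewrite addn0.
move=> [szs] /andP[far_u far_s] Phi_f.
have [g [szg <-] gE] := difference_quotient _ _ _ u szf.
rewrite addnS -addSn; apply: IHk szg szs far_s _ => x xs.
apply: PhiS (gE x); last by apply: Phi_f; rewrite mem_head.
  by move/allP: far_u; apply.
by apply: Phi_f; rewrite inE xs orbT.
Qed.

(** Greedy covering: either one keeps finding points far from all earlier ones,
    or at most k neighbourhoods cover S, and the fullest of them holds a k-th of
    S. *)
Lemma pairwise_far_or_crowded (T : eqType) (near : rel T) (k : nat) (S : seq T) :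
  (exists s, [/\ size s = k.+1, {subset s <= S}
                & pairwise (fun x y => ~~ near x y) s])
  \/ (S != [::] -> exists2 x, x \in S & (size S <= k * count (near x) S)%N).
Proof.
elim: k S => [|k IHk] [|u S]; [by right| |by right|].
  by left; exists [:: u]; split=> // x; rewrite !inE => ->.
set S1 := u :: S.
pose S2 := [seq x <- S1 | ~~ near u x].
have szS : size S1 = (count (near u) S1 + size S2)%N.
  by rewrite size_filter count_predC.
have sub2 : {subset S2 <= S1} by move=> x; rewrite mem_filter => /andP[].
case: (IHk S2) => [[s [szs subs far]]|crowded].
  left; exists (u :: s); split=> /=; first by rewrite szs.
    move=> x; rewrite inE => /predU1P[->|/subs /sub2 //]; exact: mem_head.
  rewrite far andbT; apply/allP => x /subs; by rewrite mem_filter => /andP[].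
right=> _; case: (eqVneq S2 [::]) => [S20|/crowded[x /sub2 xS cx]].
  by exists u; rewrite ?mem_head // szS S20 addn0 mulSn leq_addr.
have {}cx : (size S2 <= k * count (near x) S1)%N.
  apply: leq_trans cx _; rewrite leq_mul2l; apply/orP; right.
  by apply: leq_count_subseq; apply: filter_subseq.
case: (leqP (count (near u) S1) (count (near x) S1)) => ux.
  by exists x => //; rewrite szS mulSn leq_add.
exists u; first exact: mem_head.
by rewrite szS mulSn leq_add // (leq_trans cx) // leq_mul2l ltnW ?orbT.
Qed.

(** * Concentration in a residue class *)

(** A difference of far points has p-adic valuation at most s, so each step of
    the descent loses at most a factor p^s of divisibility. *)
Lemma padic_descent (p e s k : nat) (f : {poly int}) (t : seq int) :
  prime p -> size f = k.+1 -> size t = k.+1 ->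
  pairwise (fun x y => ~~ ((p ^ s.+1)%N %| x - y)%Z) t ->
  (forall x, x \in t -> ((p ^ e)%N %| f.[x])%Z) ->
  ((p ^ e)%N %| lead_coef f * (p ^ (s * k))%N%:Z)%Z.
Proof.
move=> pr_p szf szt far ft.
pose Phi n (y : int) : Prop := ((p ^ e)%N %| y * (p ^ (s * n))%N%:Z)%Z.
apply: (lead_coef_ind _ _ Phi _ _ _ _ szf szt far) => [|x /ft]; last first.
  by rewrite /Phi muln0 mulr1.
move=> n x u y v z; rewrite /Phi => far_ux dy dv zE.
have : ((p ^ e)%N %| (x - u) * z * (p ^ (s * n))%N%:Z)%Z.
  by rewrite zE mulrBl rpredB.
have xu0 : (0 < `|x - u|)%N.
  by rewrite absz_gt0 subr_eq0; apply: contraNneq far_ux => ->; rewrite subrr dvdz0.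
(* Split x - u into a power of p, at most p^s, and a part prime to p. *)
rewrite -(opprB u x) /= in xu0 *; rewrite abszN in xu0.
have [w co_pw wE] := pfactor_coprime pr_p xu0.
set j := logn p _ in wE.
have lejs : (j <= s)%N.
  rewrite -ltnS ltnNge; apply: contra far_ux => ltsj.
  by rewrite dvdzE /= wE dvdn_mull // dvdn_exp2l.
rewrite !dvdzE !abszM abszN /= wE -!mulnA.
rewrite Gauss_dvdr ?coprimeXl // => /dvdn_trans; apply.
by rewrite mulnCA dvdn_mul // -expnD dvdn_exp2l // mulnS leq_add2r.
Qed.

(** Minimality of s does both jobs: p^e divides b p^(s k), and for s > 0
    it does not divide b p^((s - 1) k), so that k + 1 points incongruent modulo p^s would
    contradict the descent. *)
Lemma class_mod_prime_power (p e k : nat) (f : {poly int}) (S : seq int) :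
  prime p -> (0 < k)%N -> size f = k.+1 ->
  (forall x, x \in S -> ((p ^ e)%N %| f.[x])%Z) ->
  exists s (S' : seq int),
    [/\ subseq S' S, (size S <= k * size S')%N,
        ((p ^ e)%N %| lead_coef f * (p ^ (s * k))%N%:Z)%Z
      & {in S' &, forall x y, ((p ^ s)%N %| x - y)%Z}].
Proof.
move=> pr_p k0 szf fS.
have ex_s : exists s, ((p ^ e)%N %| lead_coef f * (p ^ (s * k))%N%:Z)%Z.
  exists e; apply: dvdz_mull.
  by rewrite dvdzE /= dvdn_exp2l // leq_pmulr.
have [s ds s_min] := ex_minnP ex_s.
exists s; case: s => [|s] in ds s_min *.
  by exists S; split=> [//||//|x y _ _]; rewrite ?leq_pmull ?dvd1z.
pose near (x y : int) := ((p ^ s.+1)%N %| x - y)%Z.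
case: (pairwise_far_or_crowded _ near k S) => [[t [szt subt far]]|crowded].
  have /s_min : ((p ^ e)%N %| lead_coef f * (p ^ (s * k))%N%:Z)%Z; last by rewrite ltnn.
  by apply: padic_descent pr_p szf szt far _ => // x /subt /fS.
case: (eqVneq S [::]) => [->|/crowded[x xS cx]]; first by exists [::].
exists [seq y <- S | near x y]; split=> //; first exact: filter_subseq.
  by rewrite size_filter.
move=> y z; rewrite !mem_filter => /andP[xy _] /andP[xz _].
have -> : y - z = (x - z) - (x - y) by ring.
by rewrite rpredB.
Qed.

(** The moduli found at the successive primes are combined by their least
    common multiple, so that nothing about their coprimality has to be carried
    through the induction. *)
Lemma class_mod_primes (q k : nat) (f : {poly int}) (S : seq int) (ps : seq nat) :
  (0 < k)%N -> size f = k.+1 -> all prime ps ->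
  (forall x, x \in S -> (q %| f.[x])%Z) ->
  exists m (S' : seq int),
    [/\ (0 < m)%N, subseq S' S, (size S <= k ^ size ps * size S')%N,
        forall p, p \in ps -> ((q`_p)%N %| lead_coef f * (m ^ k)%N%:Z)%Z
      & {in S' &, forall x y, (m %| x - y)%Z}].
Proof.
move=> k0 szf; elim: ps => [|p ps IHps] /=.
  by move=> _ _; exists 1%N, S; split=> [//|//||//|x y _ _];
    rewrite ?mul1n ?dvd1z.
move=> /andP[pr_p pr_ps] fS.
have [m [S' [m0 subS' szS' dm congr_m]]] := IHps pr_ps fS.
have fS' x : x \in S' -> ((p ^ logn p q)%N %| f.[x])%Z.
  move=> /(mem_subseq subS')/fS; apply: dvdz_trans.
  by rewrite dvdzE /= -p_part dvdn_part.
have [s [S2 [subS2 szS2 ds congr_s]]] :=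
  class_mod_prime_power _ _ _ _ _ pr_p k0 szf fS'.
have p0 := prime_gt0 pr_p.
have dvd_lcm d c : (d %| lcmn m (p ^ s))%N -> (c %| lead_coef f * (d ^ k)%N%:Z)%Z ->
    (c %| lead_coef f * (lcmn m (p ^ s) ^ k)%N%:Z)%Z.
  move=> dd /dvdz_trans; apply; apply: dvdz_mul => //.
  by rewrite dvdzE /= dvdn_exp2r.
exists (lcmn m (p ^ s)), S2; split.
- by rewrite lcmn_gt0 m0 expn_gt0 p0.
- exact: subseq_trans subS2 subS'.
- by rewrite expnSr -mulnA (leq_trans szS') // leq_mul2l szS2 orbT.
- move=> p'; rewrite inE => /predU1P[->|/dm]; last first.
    by apply: dvd_lcm; rewrite dvdn_lcml.
  rewrite p_part; move: ds; rewrite expnM; apply: dvd_lcm; exact: dvdn_lcmr.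
- move=> x y xS yS; rewrite dvdz_lcm congr_s // congr_m //; exact: (mem_subseq subS2).
Qed.

(** The modulus m plays the role of |q / b|^(1/k). The conclusion is an
    inequality and not a divisibility so that it also covers q = 0, where there
    are no primes to treat. *)
Lemma class_mod_large_modulus (q k : nat) (f : {poly int}) (S : seq int) :
  (0 < k)%N -> size f = k.+1 ->
  (forall x, x \in S -> (q %| f.[x])%Z) ->
  exists m (S' : seq int),
    [/\ (0 < m)%N, subseq S' S, (size S <= k ^ size (primes q) * size S')%N,
        (q <= absz (lead_coef f) * m ^ k)%N
      & {in S' &, forall x y, (m %| x - y)%Z}].
Proof.
move=> k0 szf fS.
have pr_q : all prime (primes q) by apply/allP => p; rewrite mem_primes => /andP[].
have [m [S' [m0 subS' szS' dm congr_m]]] :=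
  class_mod_primes _ _ _ _ _ k0 szf pr_q fS.
exists m, S'; split=> //.
case: (posnP q) => [->//|q0].
have f0 : lead_coef f != 0 by rewrite lead_coef_eq0 -size_poly_eq0 szf.
apply: dvdn_leq; first by rewrite muln_gt0 absz_gt0 f0 expn_gt0 m0.
apply/(dvdn_partP _ q0) => p /dm.
by rewrite dvdzE abszM.
Qed.

(** * Concentration in an interval *)

(** Taking a difference of two values at most doubles the bound, and dividing by
    the distance of far points gains a factor D. *)
Lemma arch_descent (k B D : nat) (f : {poly int}) (t : seq int) :
  size f = k.+1 -> size t = k.+1 ->
  pairwise (fun x y => ~~ (absz (x - y)%R < D)%N) t ->
  (forall x, x \in t -> (absz f.[x] <= B)%N) ->
  (absz (lead_coef f) * D ^ k <= 2 ^ k * B)%N.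
Proof.
move=> szf szt far ft.
pose Phi n (y : int) : Prop := (absz y * D ^ n <= 2 ^ n * B)%N.
apply: (lead_coef_ind _ _ Phi _ _ _ _ szf szt far) => [|x /ft]; last first.
  by rewrite /Phi !expn0 muln1 mul1n.
move=> n x u y v z; rewrite /Phi -leqNgt -abszN opprB => far_ux Hy Hv zE.
have : (absz ((x - u) * z)%R * D ^ n <= 2 ^ n.+1 * B)%N.
  rewrite zE; apply: leq_trans (_ : (absz y + absz v) * D ^ n <= _)%N.
    by rewrite leq_mul2r; apply/orP; right; lia.
  by rewrite mulnDl expnS -mulnA mul2n -addnn leq_add.
apply: leq_trans; rewrite expnS abszM mulnA (mulnC (absz z)).
by rewrite !leq_mul2r far_ux !orbT.
Qed.

Lemma size_congr_interval (m L : nat) (x : int) (s : seq int) :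
  (0 < m)%N -> uniq s ->
  (forall y, y \in s -> (m %| x - y)%Z && (absz (x - y)%R < L * m)%N) ->
  (size s <= 2 * L)%N.
Proof.
move=> m0 us ss.
(* The shift by L m makes the quotients nonnegative; they lie in [0, 2 L). *)
pose h (y : int) := (absz ((x - y) + (L * m)%N%:Z)%R %/ m)%N.
have hE y : y \in s -> ((h y) * m)%N%:Z = (x - y) + (L * m)%N%:Z.
  move=> /ss/andP[dm lt]; rewrite /h.
  have : (m %| (x - y) + (L * m)%N%:Z)%Z.
    by rewrite rpredD // dvdzE /= dvdn_mull.
  by rewrite dvdzE /= => /divnK ->; lia.
rewrite -(size_map h) -[leqRHS](size_iota 0); apply: uniq_leq_size.
  rewrite map_inj_in_uniq // => y z ys zs hyz.
  by have := hE y ys; rewrite hyz (hE z zs); lia.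
move=> _ /mapP[y ys ->]; rewrite mem_iota add0n /=.
rewrite -(ltn_pmul2r m0) -ltz_nat hE // -mulnA.
by have /andP[_] := ss y ys; lia.
Qed.

(** * The count, and its growth in N *)

Lemma size_hits (k n L : nat) (q : int) (f : {poly int}) (S : seq int) :
  (0 < k)%N -> size f = k.+1 -> uniq S ->
  (2 ^ k * n < L ^ k)%N ->
  (forall x, x \in S -> exists2 j : int, (absz j <= n)%N & f.[x] = j * q) ->
  (size S <= k ^ size (primes (absz q)) * (k * (2 * L)))%N.
Proof.
move=> k0 szf uS HL fS.
have qS x : x \in S -> (absz q %| f.[x])%Z.
  by move=> /fS[j _ ->]; rewrite dvdzE abszM /= dvdn_mull.
have [m [S' [m0 subS' szS' q_le congr_m]]] :=
  class_mod_large_modulus _ _ _ _ k0 szf qS.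
apply: leq_trans szS' _; rewrite leq_mul2l; apply/orP; right.
pose near (x y : int) := (absz (x - y)%R < L * m)%N.
case: (pairwise_far_or_crowded _ near k S') => [[t [szt subt far]]|crowded].
  have ft x : x \in t -> (absz f.[x] <= n * absz q)%N.
    move=> /subt/(mem_subseq subS')/fS[j jn ->].
    by rewrite abszM leq_mul2r jn orbT.
  have f0 : (0 < absz (lead_coef f))%N.
    by rewrite absz_gt0 lead_coef_eq0 -size_poly_eq0 szf.
  have := arch_descent _ _ _ _ _ szf szt far ft.
  rewrite leqNgt => /negP[]; case: (posnP (absz q)) => [->|q0].
    (* For q = 0 the descent gives |b| (L m)^k <= 0. *)
    rewrite !muln0 muln_gt0 f0 expn_gt0 muln_gt0 m0 andbT /= lt0n.
    by case: (L) HL => //; rewrite exp0n.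
  rewrite mulnA expnMn mulnCA -(ltn_pmul2r q0) in HL *.
  by apply: leq_trans HL _; rewrite leq_mul2l q_le orbT.
case: (eqVneq S' [::]) => [->//|/crowded[x xS cx]].
apply: leq_trans cx _; rewrite leq_mul2l -size_filter; apply/orP; right.
apply: (size_congr_interval m L x) => //.
  by rewrite filter_uniq // (subseq_uniq subS').
by move=> y; rewrite mem_filter => /andP[near_y yS]; rewrite congr_m.
Qed.

(** The primes below B number at most B, and each other prime p pays for its
    own factor B <= p. With B = k^n this bounds k^omega(q) by a constant times
    the n-th root of q. *)
Lemma expn_size_primes (B q : nat) : (0 < B)%N ->
  (B ^ size (primes q) <= B ^ B * q.+1)%N.
Proof.
move=> B0.
have prod_primes : (\prod_(p <- primes q) p <= q.+1)%N.
  case: (posnP q) => [->|q0]; first by rewrite big_nil.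
  apply: leqW; rewrite [leqRHS](prod_prime_decomp q0) prime_decompE big_map /=.
  rewrite !big_seq; apply: leq_prod => p; rewrite mem_primes => /and3P[pr_p _ dp].
  rewrite -[leqLHS]expn1; apply: leq_pexp2l; first exact: prime_gt0.
  by rewrite logn_gt0 mem_primes pr_p q0.
set small := fun p => (p < B)%N.
rewrite -(count_predC small) expnD; apply: leq_mul.
  rewrite leq_pexp2l // -size_filter -[leqRHS](size_iota 0); apply: uniq_leq_size.
    by rewrite filter_uniq // primes_uniq.
  by move=> p; rewrite mem_filter mem_iota => /andP[].
apply: leq_trans prod_primes.
rewrite (bigID small) /= -[leqLHS]mul1n; apply: leq_mul.
  rewrite big_seq_cond; apply: prodn_cond_gt0 => p /andP[]; rewrite mem_primes.
  by move=> /andP[/prime_gt0].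
elim: (primes q) => [|p s IHs]; first by rewrite big_nil.
rewrite big_cons /=; case: (boolP (small p)) => //= Bp.
by rewrite expnS leq_mul // leqNgt.
Qed.

Lemma finite_card_le (T : choiceType) (A : set T) (b : nat) :
  (forall s : seq T, uniq s -> (forall x, x \in s -> A x) -> (size s <= b)%N) ->
  finite_set A /\ (#|` fset_set A| <= b)%N.
Proof.
move=> bound.
have finA : finite_set A.
  apply: contrapT => /(infinite_set_fset b.+1)[F FA].
  by rewrite ltnNge => /negP; apply; apply: bound => // x; apply: FA.
split=> //; apply: bound => [|x]; first exact: fset_uniq.
by rewrite in_fset_set // inE.
Qed.

Lemma expn_size_primes_le (R : realType) (k r n : nat) (c x : R) (q : int) :
  (0 < k)%N -> (0 < n)%N -> 0 < c ->
  ((k ^ n) ^ (k ^ n))%N%:R * (c + 1) < x -> 1 <= x -> `|q|%:~R <= c * x ^+ r ->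
  (k ^ size (primes (absz q)))%N%:R <= x `^ (r.+1%:R / n%:R).
Proof.
move=> k0 n0 c0 x_gt x1 q_le.
have kn0 : (0 < k ^ n)%N by rewrite expn_gt0 k0.
have := expn_size_primes (k ^ n) (absz q) kn0.
set K := ((k ^ n) ^ (k ^ n))%N in x_gt *; set w := size _.
rewrite -expnM mulnC expnM -(ler_nat R) natrM natrX => Hw.
have x0 : 0 <= x := le_trans ler01 x1.
have xr1 : 1 <= x ^+ r by rewrite exprn_ege1.
have : (k ^ w)%N%:R ^+ n <= x ^+ r.+1.
  apply: le_trans Hw _; rewrite -natr1 -[X in X%:R + 1]/(absz q).
  have -> : (absz q)%:R = `|q|%:~R :> R by rewrite -abszE -pmulrn.
  apply: le_trans (_ : K%:R * ((c + 1) * x ^+ r) <= _).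
    by rewrite ler_wpM2l // mulrDl mul1r lerD.
  by rewrite mulrA exprS ler_wpM2r ?exprn_ge0 // ltW.
have -> : x ^+ r.+1 = (x `^ (r.+1%:R / n%:R)) ^+ n.
  rewrite -[RHS]powR_mulrn ?powR_ge0 // -powRrM divfK ?powR_mulrn //.
  by rewrite pnatr_eq0 -lt0n.
by rewrite ler_pXn2r ?nnegrE ?powR_ge0 ?ler0n.
Qed.

Lemma root_ceil (R : realType) (k n : nat) :
  (0 < k)%N -> (0 < n)%N ->
  exists2 L : nat, (2 ^ k * n < L ^ k)%N & L%:R <= 3 * (n%:R : R) `^ k%:R^-1.
Proof.
move=> k0 n0; set y := n%:R `^ _.
have y1 : 1 <= y.
  by rewrite -[1](powRr0 n%:R) ler_powR ?ler1n // invr_ge0.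
have yk : y ^+ k = n%:R.
  rewrite -powR_mulrn ?powR_ge0 // -powRrM mulVf ?powRr1 //.
  by rewrite pnatr_eq0 -lt0n.
have y0 : 0 <= 2 * y by rewrite mulr_ge0 // ltW // (lt_le_trans ltr01).
exists (Num.truncn (2 * y)).+1.
  rewrite -(ltr_nat R) natrM !natrX -yk -exprMn ltr_pXn2r ?nnegrE -?lt0n //.
  by rewrite -truncn_le_nat.
rewrite -natr1; have := truncn_le (2 * y); rewrite y0 => /idP.
lra.
Qed.

Theorem theorem1p4 (R : realType) (k : nat) (hk : (1 <= k)%N) :
  exists2 C : R, 0 < C &
  forall (r : nat) (c : R), (0 < r)%N -> 0 < c ->
  forall eps : R, 0 < eps ->
  exists N0 : R,
  forall (P : {poly int}) (a q N : int),
    size P = k.+1 ->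
    0 < N -> N0 < N%:~R ->
    `|q|%:~R <= c * N%:~R ^+ r ->
    card_le_real (hits P a q N) (C * N%:~R `^ (k%:R^-1 + eps)).
Proof.
exists (6 * k%:R); first by rewrite mulr_gt0 // ltr0n.
move=> r c _ c0 eps eps0.
(* Any n >= (r + 1) / eps will do: k^omega(q) is then at most N^((r + 1) / n),
   the extra 1 in r + 1 absorbing the constants once N is large. *)
pose n := (Num.truncn (r.+1%:R / eps)).+1.
have n_eps : r.+1%:R / n%:R <= eps.
  rewrite ler_pdivrMr ?ltr0n // mulrC -ler_pdivrMr // ltW //.
  by rewrite -truncn_le_nat.
exists (((k ^ n) ^ (k ^ n))%N%:R * (c + 1)) => P a q [N|//] szP N_gt0 N_large q_le.
have N0 : (0 < N)%N by [].
rewrite -pmulrn in N_large q_le *.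
have N1 : (1 : R) <= N%:R by rewrite ler1n.
have [L L_large L_le] := root_ceil R k N hk N0.
pose f := P - a%:P.
have szf : size f = k.+1.
  rewrite size_polyDl // size_polyN szP ltnS.
  exact: leq_trans (size_polyC_leq1 _) hk.
pose b := (k ^ size (primes (absz q)) * (k * (2 * L)))%N.
have [finS cardS] : finite_set (hits P a q N) /\ (#|` fset_set (hits P a q N)| <= b)%N.
  apply: finite_card_le => s us hs.
  apply: size_hits hk szf us L_large _ => t /hs[j /= /andP[j1 jN] jE].
  exists j; first by lia.
  by rewrite !hornerE -jE; ring.
split=> //; apply: le_trans (_ : b%:R <= _); first by rewrite ler_nat.
rewrite /b !natrM powRD; last by rewrite pnatr_eq0 -lt0n N0 implybT.
have := expn_size_primes_le _ _ r n _ _ _ hk isT c0 N_large N1 q_le.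
set w := (_ ^ _)%N%:R => w_le.
have {}w_le : w <= N%:R `^ eps by apply: le_trans w_le _; rewrite ler_powR.
apply: le_trans (_ : N%:R `^ eps * (k%:R * (2 * (3 * N%:R `^ k%:R^-1))) <= _).
  by rewrite ler_pM // ?mulr_ge0 // ler_wpM2l // ler_wpM2l.
by rewrite le_eqVlt; apply/orP; left; apply/eqP; ring.
Qed.
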